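(* Let $f:\mathbb{R}^n\to[0,1]$ and $g:\mathbb{R}^m\to[0,1]$ be smooth, and let $U=\begin{pmatrix}u_{0,0}&u_{0,1}\\ u_{1,0}&u_{1,1}\end{pmatrix}$ be a real matrix with $v:=u_{0,0}-u_{0,1}-u_{1,0}+u_{1,1}\neq0$, $q:=-\frac{u_{0,1}-u_{1,1}}{v}\in(0,1)$ and $p:=-\frac{u_{1,0}-u_{1,1}}{v}\in(0,1)$. Consider the system $$\dot{\theta}=-v\,\nabla f(\theta)\,(g(\phi)-q),\qquad \dot{\phi}=v\,\nabla g(\phi)\,(f(\theta)-p),$$ and let $(\theta(0),\phi(0))\in\mathbb{R}^n\times\mathbb{R}^m$ be a safe initial condition. Then, along the solution $(\theta(t),\phi(t))$ with this initial condition, writing $f=f(\theta(t))$ and $g=g(\phi(t))$, the quantity $$H(f,g)=\int_p^{f}\frac{z-p}{\|\nabla f(X_{\theta(0)}(z))\|^2}\,dz+\int_q^{g}\frac{z-q}{\|\nabla g(X_{\phi(0)}(z))\|^2}\,dz$$ is constant in time.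
   Context: The system is continuous-time gradient-descent-ascent for $r(\theta,\phi)=F(\theta)^\top U G(\phi)$ with $F(\theta)=(f(\theta),1-f(\theta))^\top$, $G(\phi)=(g(\phi),1-g(\phi))^\top$; $(p,q)$ is the unique mixed Nash equilibrium of the hidden bilinear game $U$. $\|\cdot\|$ is the Euclidean norm. Gradient ascent dynamics of $f$ from $\theta(0)$: let $\gamma:\mathbb{R}\to\mathbb{R}^n$ be the solution of $\dot\gamma=\nabla f(\gamma)$, $\gamma(0)=\theta(0)$. Define $f_{\theta(0)}=\{f(\gamma(s)):s\in\mathbb{R}\}$ and define $X_{\theta(0)}:f_{\theta(0)}\to\mathbb{R}^n$ by $X_{\theta(0)}(f(\gamma(s)))=\gamma(s)$ (if $\theta(0)$ is a stationary point, $\gamma$ is constant; otherwise $s\mapsto f(\gamma(s))$ is strictly increasing). $g_{\phi(0)}$ and $X_{\phi(0)}:g_{\phi(0)}\to\mathbb{R}^m$ are defined in the same way from $g$ and $\phi(0)$. The initial condition $(\theta(0),\phi(0))$ is called safe if $\theta(0)$ is not a stationary point of $f$, $\phi(0)$ is not a stationary point of $g$, $p\in f_{\theta(0)}$ and $q\in g_{\phi(0)}$. *)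

(* Defs.v *)
From HB Require Import structures.
From mathcomp Require Import all_boot all_order all_algebra.
From mathcomp Require Import all_classical all_reals all_analysis.

Set Implicit Arguments.
Unset Strict Implicit.
Unset Printing Implicit Defensive.

Import Order.TTheory GRing.Theory Num.Theory.
Import numFieldNormedType.Exports.
Local Open Scope classical_set_scope.
Local Open Scope ring_scope.

(* The library norm `|x| on row vectors is the sup norm. *)
Definition eucl_norm (R : realType) (n : nat) (x : 'rV[R]_n) : R :=
  Num.sqrt (\sum_(i < n) x 0 i ^+ 2).

Definition partial (R : realType) (n : nat) (i : 'I_n) (f : 'rV[R]_n -> R) :
    'rV[R]_n -> R :=
  fun x => 'D_(delta_mx 0 i) f x.

Definition grad (R : realType) (n : nat) (f : 'rV[R]_n -> R) (x : 'rV[R]_n) :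
    'rV[R]_n :=
  \row_(i < n) partial i f x.

(* C^(k+1): Frechet differentiable everywhere, with derivative of class C^k;
   the derivative is expressed through its coordinates, the partials. *)
Fixpoint class_C (R : realType) (n k : nat) (f : 'rV[R]_n -> R) : Prop :=
  if k is k'.+1 then
    (forall x, differentiable f x) /\
    (forall i : 'I_n, class_C k' (partial i f))
  else continuous f.

Definition smooth (R : realType) (n : nat) (f : 'rV[R]_n -> R) : Prop :=
  forall k, class_C k f.

Definition stationary (R : realType) (n : nat) (f : 'rV[R]_n -> R)
    (x : 'rV[R]_n) : Prop :=
  grad f x = 0.

Definition gradient_ascent (R : realType) (n : nat) (f : 'rV[R]_n -> R)
    (x0 : 'rV[R]_n) (gamma : R -> 'rV[R]_n) : Prop :=
  gamma 0 = x0 /\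
  forall s : R, is_derive s 1 gamma (grad f (gamma s)).

(* For smooth f there is at most one gamma, so the existential quantifiers
   over gamma in the next two definitions refer to "the" ascent curve. *)
Definition ascent_values (R : realType) (n : nat) (f : 'rV[R]_n -> R)
    (x0 : 'rV[R]_n) : set R :=
  [set z | exists (gamma : R -> 'rV[R]_n) (s : R),
     gradient_ascent f x0 gamma /\ z = f (gamma s)].

(* The map f (gamma s) |-> gamma s on ascent_values f x0; its value outside
   that set is irrelevant. *)
Definition ascent_point (R : realType) (n : nat) (f : 'rV[R]_n -> R)
    (x0 : 'rV[R]_n) (z : R) : 'rV[R]_n :=
  get [set x | exists (gamma : R -> 'rV[R]_n) (s : R),
     [/\ gradient_ascent f x0 gamma, z = f (gamma s) & x = gamma s]].

Definition safe (R : realType) (n m : nat)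
    (f : 'rV[R]_n -> R) (g : 'rV[R]_m -> R) (p q : R)
    (theta0 : 'rV[R]_n) (phi0 : 'rV[R]_m) : Prop :=
  [/\ ~ stationary f theta0, ~ stationary g phi0,
      ascent_values f theta0 p & ascent_values g phi0 q].

Definition game_v (R : realType) (U : 'M[R]_2) : R :=
  U 0 0 - U 0 1 - U 1 0 + U 1 1.

Definition game_q (R : realType) (U : 'M[R]_2) : R :=
  - ((U 0 1 - U 1 1) / game_v U).

Definition game_p (R : realType) (U : 'M[R]_2) : R :=
  - ((U 1 0 - U 1 1) / game_v U).

(* x solves x' = w on the interval I, which may contain its endpoints (such as
   0 in [0, +oo[); there, only continuity is required. *)
Definition solves_on (R : realType) (n : nat) (I : interval R)
    (x w : R -> 'rV[R]_n) : Prop :=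
  {within [set` I], continuous x} /\
  forall t : R, interior [set` I] t -> is_derive t 1 x (w t).

Definition hidden_gda (R : realType) (n m : nat)
    (f : 'rV[R]_n -> R) (g : 'rV[R]_m -> R) (v p q : R) (I : interval R)
    (theta : R -> 'rV[R]_n) (phi : R -> 'rV[R]_m) : Prop :=
  solves_on I theta
    (fun t => (- v * (g (phi t) - q)) *: grad f (theta t)) /\
  solves_on I phi
    (fun t => (v * (f (theta t) - p)) *: grad g (phi t)).

(* The oriented integral from a to b, also when b < a. *)
Definition oriented_integral (R : realType) (a b : R) (h : R -> R) : R :=
  if a <= b then Rintegral (@lebesgue_measure R) `[a, b] h
  else - Rintegral (@lebesgue_measure R) `[b, a] h.

Definition gda_H (R : realType) (n m : nat)
    (f : 'rV[R]_n -> R) (g : 'rV[R]_m -> R) (p q : R)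
    (theta0 : 'rV[R]_n) (phi0 : 'rV[R]_m) (a b : R) : R :=
  oriented_integral p a
    (fun z => (z - p) / eucl_norm (grad f (ascent_point f theta0 z)) ^+ 2) +
  oriented_integral q b
    (fun z => (z - q) / eucl_norm (grad g (ascent_point g phi0 z)) ^+ 2).

(* Main.v *)
Require Import Defs.
From HB Require Import structures.
From mathcomp Require Import all_boot all_order all_algebra.
From mathcomp Require Import all_classical all_reals all_analysis.
From mathcomp Require Import ring lra.

Set Implicit Arguments.
Unset Strict Implicit.
Unset Printing Implicit Defensive.

Import Order.TTheory GRing.Theory Num.Theory.
Import numFieldNormedType.Exports.
Local Open Scope classical_set_scope.
Local Open Scope ring_scope.

(** The theta-component of the dynamics is the gradient ascent of f run at a
variable signed speed: with c(t) = - v (g (phi t) - q), it solves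
x' = c(t) grad f x. If gamma is the ascent curve through theta0 and
tau(t) = int_0^t c, then gamma o tau solves the same equation with the same
initial value, so theta = gamma o tau by uniqueness ([time_changed_ascent]).
Likewise phi = delta o sigma with sigma' = v (f (theta t) - p).

Along gamma the value f increases at the speed |grad f|^2, which never
vanishes because a curve meeting a stationary point would be constant. So the
substitution z = f (gamma u) is legitimate and cancels the denominator of the
first integral of H ([oriented_integral_ascent]): if p = f (gamma r), then
  int_p^(f (gamma s)) (z - p) / |grad f (X z)|^2 dz
    = int_r^s (f (gamma u) - p) du.
Therefore H (f (theta t), g (phi t)) = A (tau t) + B (sigma t) where
A' = f o gamma - p and B' = g o delta - q, and its time derivative is
(f - p) * (- v (g - q)) + (g - q) * (v (f - p)) = 0.

Uniqueness needs grad f to be Lipschitz on bounded sets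
([smooth_grad_lipschitz]): the squared Euclidean distance E between two
solutions then satisfies |E'| <= K E, and a Gronwall argument
([gronwall_eq0]) forces it to remain 0.

The interval I may contain its endpoints, where the solution is only
continuous. Freezing the speed c outside a segment [a, b] of I makes tau and
sigma differentiable on the whole line, so that no one-sided derivative ever
appears. *)

(** * Calculus of curves in row vector spaces *)

Lemma diff_partial (R : realType) (n : nat) (f : 'rV[R]_n -> R)
    (x v : 'rV[R]_n) :
  differentiable f x -> 'd f x v = \sum_(j < n) v 0 j * partial j f x.
Proof.
move=> df; rewrite {1}[v]row_sum_delta linear_sum.
by apply: eq_bigr => j _; rewrite linearZ /= /partial deriveE.
Qed.

(** The chain rule for a scalar function along a curve, with the differential
spelled out through the partial derivatives, since the gradient and the
smoothness class are defined from them. *)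
Lemma is_derive_comp_curve (R : realType) (n : nat) (f : 'rV[R]_n -> R)
    (c : R -> 'rV[R]_n) (s : R) (v : 'rV[R]_n) :
  differentiable f (c s) -> is_derive s 1 c v ->
  is_derive s 1 (f \o c) (\sum_(j < n) v 0 j * partial j f (c s)).
Proof.
move=> df [dc cv].
have dc' : differentiable c s by apply/derivable1_diffP.
have dfc : differentiable (f \o c) s by apply: differentiable_comp.
apply: DeriveDef; first exact/derivable1_diffP.
by rewrite deriveE// diff_comp//= -(deriveE _ dc') cv diff_partial.
Qed.

Lemma eucl_norm_sqr (R : realType) (n : nat) (x : 'rV[R]_n) :
  eucl_norm x ^+ 2 = \sum_(i < n) x 0 i ^+ 2.
Proof. by rewrite sqr_sqrtr// sumr_ge0// => i _; exact: sqr_ge0. Qed.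

(** The norm of row vectors is the sup norm; topological facts are
stated for it, energy estimates for the Euclidean one. *)
Lemma normr_le_eucl_norm (R : realType) (n : nat) (x : 'rV[R]_n) :
  `|x| <= eucl_norm x.
Proof.
rewrite [leLHS]/Num.norm/= mx_normrE; apply: bigmax_le => [|[i j] _ /=].
  exact: sqrtr_ge0.
rewrite ord1 -sqrtr_sqr ler_wsqrtr// (bigD1 j)//= lerDl.
by apply: sumr_ge0 => k _; exact: sqr_ge0.
Qed.

Lemma normr_coord_le (R : realType) (n : nat) (x : 'rV[R]_n) (j : 'I_n) :
  `|x 0 j| <= `|x|.
Proof.
rewrite [leRHS]/Num.norm/= mx_normrE.
exact: (le_bigmax _ (fun ij : 'I_1 * 'I_n => `|x ij.1 ij.2|) (0, j)).
Qed.

Lemma compact_continuous_bound (R : realType) (T : topologicalType)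
    (V : normedModType R) (A : set T) (f : T -> V) :
  compact A -> {within A, continuous f} ->
  exists B : R, forall x, A x -> `|f x| <= B.
Proof.
move=> cptA cf.
have /compact_bounded[B [_ /(_ (B + 1))]] := continuous_compact cf cptA.
by rewrite ltrDl => /(_ ltr01) hB; exists (B + 1) => x Ax; apply: hB; exists x.
Qed.

(** On a ball the partial derivatives are bounded, by compactness; balls being
convex, the mean value theorem along the segment from y to x gives the
estimate with the sum of these bounds as constant. *)
Lemma class_C1_lipschitz (R : realType) (n : nat) (f : 'rV[R]_n -> R) (M : R) :
  class_C 1 f ->
  exists2 L, 0 <= L & forall x y : 'rV[R]_n, `|x| <= M -> `|y| <= M ->
    `|f x - f y| <= L * `|x - y|.
Proof.
move=> [df dfc].
have cptB : compact (closed_ball_ Num.norm (0 : 'rV[R]_n) M).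
  apply: bounded_closed_compact; last exact: closed_closed_ball_.
  exists M; split; first exact: num_real.
  move=> N MN x; rewrite /closed_ball_/= sub0r normrN => /le_trans->//.
  exact: ltW.
have bnd (j : 'I_n) : exists B : R, forall x : 'rV[R]_n, `|x| <= M ->
    `|partial j f x| <= B.
  have [|B hB] := @compact_continuous_bound _ _ _ _ (partial j f) cptB.
    by apply: continuous_subspaceT; exact: dfc.
  by exists B => x xM; apply: hB; rewrite /closed_ball_/= sub0r normrN.
have [B hB] := choice bnd.
exists (\sum_j `|B j|); first by apply: sumr_ge0 => j _.
move=> x y xM yM.
pose l (r : R) : 'rV[R]_n := r *: (x - y) + y.
have dl (r : R) : is_derive r 1 l (x - y).
  have -> : l = ( *:%R^~ (x - y)) + cst y by apply/funext.
  apply: is_derive_eq; last exact: addr0.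
  apply: is_deriveD; apply: DeriveDef.
    by apply/derivable1_diffP; exact: differentiableZl.
  by rewrite deriveE ?diffZl//= ?diff_val ?scale1r.
have dfl r := is_derive_comp_curve (df (l r)) (dl r).
have [c c01] := MVT_segment ler01 (fun r _ => dfl r)
  (derivable_within_continuous (fun r _ => @ex_derive _ _ _ _ _ _ _ (dfl r))).
rewrite /= /l scale1r subrK scale0r add0r subr0 mulr1 => ->.
rewrite (le_trans (ler_norm_sum _ _ _))// mulr_suml ler_sum// => j _.
rewrite normrM mulrC ler_pM//; last exact: normr_coord_le.
rewrite (le_trans _ (ler_norm _))// hB//.
have /andP[c0 c1] : 0 <= c <= 1 by move: c01; rewrite in_itv.
(* The intermediate point lies in the ball, as a convex combination. *)
have -> : c *: (x - y) + y = c *: x + (1 - c) *: y.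
  by rewrite scalerBr scalerBl scale1r addrAC addrA.
rewrite (le_trans (ler_normD _ _))// !normrZ.
rewrite (ger0_norm c0) ger0_norm ?subr_ge0//.
rewrite [leRHS](_ : M = c * M + (1 - c) * M); last by ring.
by rewrite lerD// ler_wpM2l// subr_ge0.
Qed.

(** * Uniqueness for x' = c(t) F(x) *)

Lemma is_derive_coord (R : realType) (n : nat) (c : R -> 'rV[R]_n)
    (s : R) (v : 'rV[R]_n) (i : 'I_n) :
  is_derive s 1 c v -> is_derive s 1 (fun t => c t 0 i) (v 0 i).
Proof.
move=> [dc <-]; apply: DeriveDef; first exact: (derivable_mxP _ _ _).1.
by rewrite derive_mx// mxE.
Qed.

Lemma continuous_sqr_eucl (R : realType) (n : nat) :
  continuous (fun u : 'rV[R]_n => \sum_(i < n) u 0 i ^+ 2).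
Proof.
move=> u; apply: differentiable_continuous.
rewrite (_ : (fun _ => _) =
    \sum_(i < n) ((fun w : 'rV[R]_n => w 0 i) ^+ 2)); last first.
  by apply/funext => w; rewrite fct_sumE.
apply: differentiable_sum => i; apply: differentiableX.
exact: differentiable_coord.
Qed.

(** The bound on |E'| makes E exp (- K t) nonincreasing and E exp (K t)
nondecreasing: the first shows E <= 0 to the right of t0, the second to its
left. *)
Lemma gronwall_eq0 (R : realType) (E dE : R -> R) (a b t0 K : R) :
  t0 \in `[a, b] -> {within `[a, b], continuous E} ->
  (forall t, t \in `]a, b[ -> is_derive t 1 E (dE t)) ->
  (forall t, t \in `]a, b[ -> `|dE t| <= K * E t) ->
  (forall t, 0 <= E t) -> E t0 = 0 ->
  forall t, t \in `[a, b] -> E t = 0.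
Proof.
move=> t0ab cE dE_ bE E0 Et0 t tab.
have dexp (k u : R) : is_derive u 1 (fun s => expR (k * s)) (expR (k * u) * k).
  apply: (@is_derive1_comp _ expR (fun s => k * s)).
  by apply: is_derive_eq; rewrite /= /GRing.scale /= mulr1.
have dW k u : u \in `]a, b[ -> is_derive u 1 (fun s => E s * expR (k * s))
    ((dE u + k * E u) * expR (k * u)).
  move=> uab; have := dE_ u uab => dEu.
  by apply: is_derive_eq; rewrite /GRing.scale /=; lra.
have cW k : {within `[a, b], continuous (fun s => E s * expR (k * s))}.
  move=> u; apply: cvgM; first exact: cE.
  apply: (@continuous_subspaceT _ _ _ (fun s => expR (k * s))).
  move=> s; apply: differentiable_continuous; apply/derivable1_diffP.
  exact: ex_derive.
apply/eqP; rewrite eq_le E0 andbT.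
have [tt0|/ltW tt0] := leP t0 t.
- have := @ler0_derive1_le_cc _ _ a b _ _ (cW (- K)) t t0 tab t0ab tt0.
  rewrite Et0 mul0r pmulr_lle0 ?expR_gt0//; apply.
  + by move=> u uab; have [] := dW (- K) u uab.
  + move=> u uab; have [_] := dW (- K) u uab.
    rewrite derive1E => ->; rewrite pmulr_lle0 ?expR_gt0//.
    by have := le_trans (ler_norm _) (bE u uab); lra.
- have := @ger0_derive1_le_cc _ _ a b _ _ (cW K) t t0 tab t0ab tt0.
  rewrite Et0 mul0r pmulr_lle0 ?expR_gt0//; apply.
  + by move=> u uab; have [] := dW K u uab.
  + move=> u uab; have [_] := dW K u uab.
    rewrite derive1E => ->; rewrite pmulr_lge0 ?expR_gt0//.
    by have := ler_norm (- dE u); have := bE u uab; rewrite normrN; lra.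
Qed.

(** A continuous curve on [a, b] is bounded, so a Lipschitz condition on bounded
sets is enough; it bounds the derivative of the squared Euclidean distance
between the solutions by a multiple of this distance. The scalar factor c is
what lets the lemma apply to time-changed gradient flows, and not only to
gradient ascent itself. *)
Lemma ode_unique (R : realType) (n : nat) (F : 'rV[R]_n -> 'rV[R]_n)
    (c : R -> R) (a b t0 : R) (x y : R -> 'rV[R]_n) :
  (forall M, exists2 L, 0 <= L & forall u v : 'rV[R]_n, `|u| <= M ->
    `|v| <= M -> `|F u - F v| <= L * `|u - v|) ->
  {within `[a, b], continuous c} -> t0 \in `[a, b] ->
  solves_on `[a, b] x (fun t => c t *: F (x t)) ->
  solves_on `[a, b] y (fun t => c t *: F (y t)) ->
  x t0 = y t0 -> forall t, t \in `[a, b] -> x t = y t.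
Proof.
move=> lipF cc t0ab [cx dx] [cy dy] xy0 t tab.
have cpt : compact `[a, b] by exact: segment_compact.
have [Mx hMx] := compact_continuous_bound cpt cx.
have [My hMy] := compact_continuous_bound cpt cy.
have [C hC] := compact_continuous_bound cpt cc.
have [L L0 hL] := lipF (Num.max Mx My).
pose E (s : R) := \sum_(i < n) (x s - y s) 0 i ^+ 2.
pose dE (s : R) := \sum_(i < n)
  2 * (x s - y s) 0 i * (c s * (F (x s) - F (y s)) 0 i).
suff E0 : E t = 0.
  apply/subr0_eq/eqP; rewrite -normr_eq0 eq_le normr_ge0 andbT.
  rewrite (le_trans (normr_le_eucl_norm _))// -sqrtr0 /eucl_norm.
  by rewrite -[X in Num.sqrt X]/(E t) E0.
apply: (@gronwall_eq0 _ E dE a b t0 (n%:R * (2 * C * L))) => //.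
- move=> s; apply: (@continuous_comp (subspace `[a, b]) _ _ (fun s => x s - y s)
    (fun u : 'rV[R]_n => \sum_(i < n) u 0 i ^+ 2)).
    by apply: cvgB; [exact: cx|exact: cy].
  exact: continuous_sqr_eucl.
- move=> s sab.
  have sI : `[a, b]° s by rewrite interior_itv_bnd.
  have -> : E = \sum_(i < n) ((fun s => (x s - y s) 0 i) ^+ 2).
    by apply/funext => r; rewrite fct_sumE.
  apply: is_derive_sum => i.
  have dxi := is_derive_coord i (dx s sI).
  have dyi := is_derive_coord i (dy s sI).
  have -> : (fun s => (x s - y s) 0 i) =
      (fun s => x s 0 i) - (fun s => y s 0 i).
    by apply/funext => r; rewrite !mxE.
  by apply: is_derive_eq; rewrite /GRing.scale/= !mxE expr1 -mulrBr.
- move=> s /subset_itv_oo_cc sab.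
  rewrite (le_trans (ler_norm_sum _ _ _))//.
  have -> : n%:R * (2 * C * L) * E s = \sum_(i < n) 2 * C * L * E s.
    by rewrite sumr_const card_ord -[RHS]mulr_natl [RHS]mulrA.
  apply: ler_sum => i _.
  have xi : `|(x s - y s) 0 i| <= Num.sqrt (E s).
    exact: le_trans (normr_coord_le _ _) (normr_le_eucl_norm _).
  have Fi : `|(F (x s) - F (y s)) 0 i| <= L * Num.sqrt (E s).
    rewrite (le_trans (normr_coord_le _ _))//.
    rewrite (le_trans (hL _ _ _ _))//.
    + by rewrite le_max hMx.
    + by rewrite le_max hMy ?orbT.
    + by rewrite ler_wpM2l//; exact: normr_le_eucl_norm.
  rewrite !normrM ger0_norm// -(@sqr_sqrtr _ (E s)); last first.
    by apply: sumr_ge0 => j _; exact: sqr_ge0.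
  have Cs : `|c s| <= C by exact: hC.
  rewrite [leRHS](_ : _ = 2 * Num.sqrt (E s) * (C * (L * Num.sqrt (E s)))).
    by rewrite !ler_pM// ?mulr_ge0// normr_ge0.
  ring.
- by move=> s; apply: sumr_ge0 => i _; exact: sqr_ge0.
- by rewrite /E big1// => i _; rewrite xy0 subrr mxE expr0n.
Qed.

(** * Oriented integrals of continuous functions *)

(** A base point to the left of both bounds removes the case distinction in the
definition of the oriented integral. *)
Lemma oriented_integral_from (R : realType) (h : R -> R) (c a b : R) :
  continuous h -> c <= a -> c <= b ->
  oriented_integral a b h =
    Rintegral (@lebesgue_measure R) `[c, b] h
    - Rintegral (@lebesgue_measure R) `[c, a] h.
Proof.
move=> ch.
have ih (u w : R) : (@lebesgue_measure R).-integrable `[u, w] (EFin \o h).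
  apply: continuous_compact_integrable; first exact: segment_compact.
  exact: continuous_subspaceT.
have sub (u w : R) : c <= u -> u <= w ->
    Rintegral (@lebesgue_measure R) `[c, w] h
    - Rintegral (@lebesgue_measure R) `[c, u] h
    = Rintegral (@lebesgue_measure R) `[u, w] h.
  move=> cu uw; rewrite Rintegral_itvB ?bnd_simp//.
  rewrite Rintegral_itv_obnd_cbnd//.
  by apply: integrableS (ih u w) => //; exact: subset_itv_oc_cc.
move=> ca cb; rewrite /oriented_integral; case: ifPn => [ab|].
  by rewrite -sub.
by rewrite -ltNge => /ltW ba; rewrite -sub// opprB.
Qed.

Lemma oriented_integral_refl (R : realType) (h : R -> R) (a : R) :
  oriented_integral a a h = 0.
Proof. by rewrite /oriented_integral lexx set_itv1 Rintegral_set1. Qed.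

Lemma is_derive_oriented_integral (R : realType) (h : R -> R) (a x : R) :
  continuous h -> is_derive x 1 (fun y => oriented_integral a y h) (h x).
Proof.
move=> ch.
(* The fundamental theorem differentiates at interior points only, so the base
   point must lie strictly to the left of x, and to the left of a. *)
pose c := Num.min a x - 1.
have ca : c < a by rewrite /c ltrBlDr gt_min ltrDl ltr01.
have cx : c < x by rewrite /c ltrBlDr gt_min ltrDl ltr01 orbT.
have xx1 : x < x + 1 by rewrite ltrDl.
have [dI eI] := @continuous_FTC1_closed R h c x (x + 1) xx1
  (continuous_compact_integrable (@segment_compact R c (x + 1))
    (continuous_subspaceT ch)) cx (ch x).
apply: (@near_eq_is_derive _ _ _
  (fun y => Rintegral (@lebesgue_measure R) `[c, y] h
    - Rintegral (@lebesgue_measure R) `[c, a] h)).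
  near=> y; rewrite (@oriented_integral_from _ _ c)//; first exact: ltW.
  by apply: ltW; near: y; exact: lt_nbhsr.
apply: is_derive_eq; last exact: subr0.
have dI' : is_derive x 1
    (fun y => Rintegral (@lebesgue_measure R) `[c, y] h) (h x).
  by apply: DeriveDef; [exact: dI|rewrite -derive1E].
exact: is_deriveB dI' (is_derive_cst _ _ _).
Unshelve. all: by end_near. Qed.

(** A continuous injection of the line is a homeomorphism onto its image, which
is open; hence h agrees near F s with (h o F) o F^-1. *)
Lemma continuous_on_image (R : realType) (T : topologicalType) (F : R -> R)
    (h : R -> T) :
  continuous F -> injective F -> continuous (h \o F) ->
  forall s, {for F s, continuous h}.
Proof.
move=> cF injF chF s.
pose G z := xget 0 [set r | F r = z].
have FK : cancel F G.
  by move=> r; apply: injF; rewrite /G; case: xgetP => // /(_ r) /=.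
have [cG GK] : {near F s, continuous G} /\ {near F s, cancel G F}.
  by apply: near_can_continuousAcan_sym; exact: (@filterE _ (nbhs s)).
have hG : h x @[x --> F s] --> (h \o F) (G (F s)).
  apply: (@cvg_trans _ ((h \o F \o G) x @[x --> F s])).
    by apply: near_eq_cvg; near=> z; rewrite /= (near GK z).
  apply: (@continuous_comp _ _ _ G (h \o F) (F s)); last exact: chF.
  exact: nbhs_singleton cG.
by move: hG; rewrite /= FK.
Unshelve. all: by end_near. Qed.

(** Continuity is required of h o F rather than of h, because the integrands of
interest are explicit along the curve but only defined through an inverse as
functions of the value. *)
Lemma oriented_integral_substitution (R : realType) (F dF h : R -> R) :
  (forall s : R, is_derive s 1 F (dF s)) -> continuous dF ->
  (forall s, 0 < dF s) -> continuous (h \o F) ->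
  forall a b, oriented_integral (F a) (F b) h
    = oriented_integral a b (fun s => h (F s) * dF s).
Proof.
move=> dF_ cdF dF0 chF.
have cF : continuous F.
  move=> s; apply/differentiable_continuous/derivable1_diffP.
  exact: ex_derive.
have F'E : derive1 F = dF by apply/funext => s; rewrite derive1E derive_val.
have incF a b : a < b -> F a < F b.
  move=> ab; apply: (@gtr0_derive1_lt_cc _ F a b) => //.
  - by move=> s _; rewrite F'E.
  - exact: continuous_subspaceT.
  - by rewrite in_itv/= lexx ltW.
  - by rewrite in_itv/= lexx ltW.
have injF : injective F.
  by move=> a b ab; case: (ltgtP a b) => // /incF; rewrite ab ltxx.
have ch := continuous_on_image cF injF chF.
have le_case a b : a <= b ->
    Rintegral (@lebesgue_measure R) `[F a, F b] h
    = Rintegral (@lebesgue_measure R) `[a, b] (fun s => h (F s) * dF s).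
  move=> ab; rewrite /Rintegral integration_by_substitution_increasing ?F'E//.
  - by move=> x y _ _; exact: incF.
  - by apply: (@cvgP _ _ (dF a)); apply: cvg_at_right_filter; apply: cdF.
  - by apply: (@cvgP _ _ (dF b)); apply: cvg_at_left_filter; apply: cdF.
  - split.
    + by move=> s _.
    + by apply: cvg_at_right_filter; apply: cF.
    + by apply: cvg_at_left_filter; apply: cF.
  - apply: continuous_in_subspaceT => z /set_mem zab.
    have := @segment_continuous_le_surjective _ a b F ab.
    move/(_ (ltW_homo incF ab) (continuous_subspaceT cF) z zab) => [r _ <-].
    exact: ch.
move=> a b; rewrite /oriented_integral.
have [ab|ba] := leP a b.
  by rewrite (ltW_homo incF)// le_case.
by rewrite leNgt incF//= le_case// ltW.
Qed.

(** * Gradient ascent curves *)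

Lemma smooth_differentiable (R : realType) (n : nat) (f : 'rV[R]_n -> R) :
  smooth f -> forall x, differentiable f x.
Proof. by move=> /(_ 1%N)[]. Qed.

Lemma smooth_grad_lipschitz (R : realType) (n : nat) (f : 'rV[R]_n -> R)
    (M : R) :
  smooth f -> exists2 L, 0 <= L & forall x y : 'rV[R]_n, `|x| <= M ->
    `|y| <= M -> `|grad f x - grad f y| <= L * `|x - y|.
Proof.
move=> /(_ 2%N)[_ C1].
have /choice[L hL] : forall i, exists L, 0 <= L /\
    forall x y : 'rV[R]_n, `|x| <= M -> `|y| <= M ->
      `|partial i f x - partial i f y| <= L * `|x - y|.
  by move=> i; have [L L0 hL] := class_C1_lipschitz M (C1 i); exists L.
exists (\sum_i L i) => [|x y xM yM].
  by apply: sumr_ge0 => i _; have [] := hL i.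
rewrite [leLHS]/Num.norm/= mx_normrE; apply: bigmax_le => [|[i j] _ /=].
  by rewrite mulr_ge0// sumr_ge0// => i _; have [] := hL i.
rewrite !mxE (le_trans ((hL j).2 x y xM yM))// ler_wpM2r//.
by rewrite (bigD1 j)//= lerDl sumr_ge0// => k _; have [] := hL k.
Qed.

Lemma is_derive_solves_on (R : realType) (n : nat) (I : interval R)
    (x w : R -> 'rV[R]_n) :
  (forall t : R, is_derive t 1 x (w t)) -> solves_on I x w.
Proof.
move=> dx; split; last by move=> t _; exact: dx.
by apply: derivable_within_continuous => t _; exact: ex_derive.
Qed.

(** The base point t0 is arbitrary, so that a curve can be compared with a
constant one at a time other than 0. *)
Lemma gradient_flow_unique (R : realType) (n : nat) (f : 'rV[R]_n -> R)
    (x y : R -> 'rV[R]_n) (t0 : R) :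
  smooth f ->
  (forall t : R, is_derive t 1 x (grad f (x t))) ->
  (forall t : R, is_derive t 1 y (grad f (y t))) ->
  x t0 = y t0 -> x =1 y.
Proof.
move=> sf dx dy xy0 t.
have H (z : R -> 'rV[R]_n) : (forall t : R, is_derive t 1 z (grad f (z t))) ->
    forall I, solves_on I z (fun t => 1 *: grad f (z t)).
  by move=> dz I; apply: is_derive_solves_on => r; rewrite scale1r.
apply: (@ode_unique R n (grad f) (cst 1) (Num.min t t0) (Num.max t t0) t0).
- by move=> M; exact: smooth_grad_lipschitz.
- by apply: continuous_subspaceT; exact: cst_continuous.
- by rewrite in_itv/= ge_min le_max lexx !orbT.
- exact: H.
- exact: H.
- exact: xy0.
- by rewrite in_itv/= ge_min le_max lexx.
Qed.

Section ascent_curve.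
Context (R : realType) (n : nat) (f : 'rV[R]_n -> R) (x0 : 'rV[R]_n)
  (gamma : R -> 'rV[R]_n).
Context (f_smooth : smooth f) (x0_nonstat : ~ stationary f x0)
  (gamma_ascent : gradient_ascent f x0 gamma).

Local Notation speed2 := (fun s => eucl_norm (grad f (gamma s)) ^+ 2).

(** At a zero of the gradient the constant curve is another ascent curve, so by
uniqueness gamma is constant and its starting point is stationary. *)
Lemma ascent_speed_gt0 s : 0 < eucl_norm (grad f (gamma s)) ^+ 2.
Proof.
have [g0 dg] := gamma_ascent.
rewrite exprn_gt0// lt0r sqrtr_ge0 andbT; apply/eqP => N0.
have grad0 : grad f (gamma s) = 0.
  apply/eqP; rewrite -normr_eq0 eq_le normr_ge0 andbT -N0.
  exact: normr_le_eucl_norm.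
apply: x0_nonstat; rewrite /stationary -g0.
have dcst (t : R) : is_derive t 1 (cst (gamma s)) (grad f (gamma s)).
  by rewrite grad0; exact: is_derive_cst.
by rewrite (gradient_flow_unique f_smooth dg dcst (erefl (gamma s)) 0).
Qed.

Lemma is_derive_ascent_value (s : R) :
  is_derive s 1 (f \o gamma) (eucl_norm (grad f (gamma s)) ^+ 2).
Proof.
have [_ dg] := gamma_ascent.
apply: is_derive_eq.
  by apply: (is_derive_comp_curve _ (dg s)); exact: smooth_differentiable.
rewrite eucl_norm_sqr; apply: eq_bigr => j _.
by rewrite mxE expr2.
Qed.

Lemma ascent_continuous : continuous gamma.
Proof.
have [_ dg] := gamma_ascent.
by move=> s; apply/differentiable_continuous/derivable1_diffP; exact: ex_derive.
Qed.

Lemma ascent_value_continuous : continuous (f \o gamma).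
Proof.
move=> s; apply: continuous_comp; first exact: ascent_continuous.
exact/differentiable_continuous/smooth_differentiable.
Qed.

Lemma ascent_speed_continuous : continuous speed2.
Proof.
move=> s; apply: (@continuous_comp _ _ _ gamma
  (fun x => eucl_norm (grad f x) ^+ 2)); first exact: ascent_continuous.
apply: differentiable_continuous.
rewrite (_ : (fun _ => _) = \sum_(i < n) partial i f ^+ 2).
  apply: differentiable_sum => i; apply: differentiableX.
  by have [_ /(_ i)[]] := f_smooth 2.
apply/funext => x; rewrite fct_sumE eucl_norm_sqr.
by apply: eq_bigr => i _; rewrite mxE.
Qed.

Lemma ascent_value_inj : injective (f \o gamma).
Proof.
suff lt_inc a b : a < b -> f (gamma a) < f (gamma b).
  move=> a b /= ab.
  by case: (ltgtP a b) => // /lt_inc; rewrite ab ltxx.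
move=> ab; apply: (@gtr0_derive1_lt_cc _ (f \o gamma) a b) => //.
- by move=> s _; have [] := is_derive_ascent_value s.
- move=> s _; rewrite derive1E; have [_ ->] := is_derive_ascent_value s.
  exact: ascent_speed_gt0.
- exact: continuous_subspaceT ascent_value_continuous.
- by rewrite in_itv/= lexx ltW.
- by rewrite in_itv/= lexx ltW.
Qed.

(** The choice made in [ascent_point] is forced: the ascent curve is unique, and
each value is taken once along it. *)
Lemma ascent_point_curve s : ascent_point f x0 (f (gamma s)) = gamma s.
Proof.
pose P := [set x | exists (c : R -> 'rV[R]_n) (r : R),
  [/\ gradient_ascent f x0 c, f (gamma s) = f (c r) & x = c r]].
have : P (ascent_point f x0 (f (gamma s))).
  by apply: (@getPex _ P); exists (gamma s), gamma, s.
move=> [d [r [[d0 dd] fE ->]]].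
have [g0 dg] := gamma_ascent.
have dE : d =1 gamma.
  by apply: (gradient_flow_unique (t0 := 0)) => //; rewrite d0.
by move: fE; rewrite dE => /ascent_value_inj <-.
Qed.

(** Under z = f (gamma u) one has dz = |grad f (gamma u)|^2 du, which is exactly
the denominator of the integrand. *)
Lemma oriented_integral_ascent r s :
  let p := f (gamma r) in
  oriented_integral p (f (gamma s))
    (fun z => (z - p) / eucl_norm (grad f (ascent_point f x0 z)) ^+ 2)
  = oriented_integral r s (fun u => f (gamma u) - p).
Proof.
move=> p; pose h z := (z - p) / eucl_norm (grad f (ascent_point f x0 z)) ^+ 2.
have hE u : h (f (gamma u)) =
    (f (gamma u) - p) / eucl_norm (grad f (gamma u)) ^+ 2.
  by rewrite /h ascent_point_curve.
rewrite -[LHS]/(oriented_integral ((f \o gamma) r) ((f \o gamma) s) h).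
rewrite (@oriented_integral_substitution _ _ speed2 _ is_derive_ascent_value
  ascent_speed_continuous ascent_speed_gt0).
- congr oriented_integral; apply/funext => u /=.
  by rewrite hE divfK// gt_eqF// ascent_speed_gt0.
- rewrite (_ : h \o _ = (fun u =>
      (f (gamma u) - p) / eucl_norm (grad f (gamma u)) ^+ 2)); last first.
    by apply/funext => u /=; rewrite hE.
  move=> u; apply: cvgM.
    apply: cvgB; [exact: ascent_value_continuous|exact: cvg_cst].
  apply: cvgV; last exact: ascent_speed_continuous.
  by rewrite gt_eqF// ascent_speed_gt0.
Qed.

End ascent_curve.

(** * Time-changed gradient ascent *)

Lemma solves_on_sub (R : realType) (n : nat) (J I : interval R)
    (x w : R -> 'rV[R]_n) :
  [set` J] `<=` [set` I] -> solves_on I x w -> solves_on J x w.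
Proof.
move=> JI [cx dx]; split; first exact: continuous_subspaceW JI cx.
by move=> t /(interiorS JI); exact: dx.
Qed.

(** The retraction of the line onto [a, b]; composing with it extends a function
from [a, b] to the line, by constants. *)
Definition clamp (R : realType) (a b t : R) : R := Num.max a (Num.min b t).

Lemma clamp_in (R : realType) (a b t : R) : a <= b -> clamp a b t \in `[a, b].
Proof. by move=> ab; rewrite in_itv/= le_max lexx/= ge_max ab ge_min lexx. Qed.

Lemma clamp_id (R : realType) (a b t : R) : t \in `[a, b] -> clamp a b t = t.
Proof. by rewrite in_itv/= => /andP[at_ tb]; rewrite /clamp min_r// max_r. Qed.

Lemma continuous_comp_clamp (R : realType) (T : topologicalType) (h : R -> T)
    (a b : R) :
  a <= b -> {within `[a, b], continuous h} -> continuous (h \o clamp a b).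
Proof.
move=> ab ch t.
have cclamp : continuous (clamp a b).
  move=> s; apply: (@continuous_max _ _ (cst a) (fun u => Num.min b u)).
    exact: cvg_cst.
  by apply: (@continuous_min _ _ (cst b) id); [exact: cvg_cst|exact: cvg_id].
move=> A /(ch (clamp a b t)).
rewrite /nbhs/= /nbhs_subspace/= mem_set; last exact: clamp_in.
move=> /(cclamp t) /=; rewrite /within/= nbhs_simpl/=.
by apply: filterS => s; apply; exact: clamp_in.
Qed.

Lemma is_derive_comp_time (R : realType) (n : nat) (c : R -> 'rV[R]_n)
    (tau : R -> R) (t dtau : R) (v : 'rV[R]_n) :
  is_derive t 1 tau dtau -> is_derive (tau t) 1 c v ->
  is_derive t 1 (c \o tau) (dtau *: v).
Proof.
move=> [/derivable1_diffP dt et] [/derivable1_diffP dc ec].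
have dct : differentiable (c \o tau) t by apply: differentiable_comp.
apply: DeriveDef; first exact/derivable1_diffP.
rewrite deriveE// diff_comp//= -(deriveE _ dt) et -ec (deriveE _ dc).
by rewrite -[in LHS](mulr1 dtau) linearZ.
Qed.

(** With tau' = c, the curve gamma o tau solves x' = c(t) grad f x from x0, so
it is the solution. The speed c is extended by constants to have tau
differentiable on the whole line. *)
Lemma time_changed_ascent (R : realType) (n : nat) (f : 'rV[R]_n -> R)
    (x0 : 'rV[R]_n) (gamma x : R -> 'rV[R]_n) (a b : R) (c : R -> R) :
  smooth f -> gradient_ascent f x0 gamma -> x 0 = x0 -> 0 \in `[a, b] ->
  {within `[a, b], continuous c} ->
  solves_on `[a, b] x (fun t => c t *: grad f (x t)) ->
  forall t, t \in `[a, b] ->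
    x t = gamma (oriented_integral 0 t (c \o clamp a b)).
Proof.
move=> sf [g0 dg] x00 ab0 cc sx.
have ab : a <= b by move: ab0; rewrite in_itv/= => /andP[]; exact: le_trans.
have ccl := continuous_comp_clamp ab cc.
pose tau t := oriented_integral 0 t (c \o clamp a b).
have dy (t : R) : is_derive t 1 (gamma \o tau)
    (c (clamp a b t) *: grad f (gamma (tau t))).
  exact: (is_derive_comp_time (is_derive_oriented_integral 0 t ccl) (dg _)).
apply: (@ode_unique R n (grad f) c a b 0 x (gamma \o tau)) => //.
- by move=> M; exact: smooth_grad_lipschitz.
- have [cy _] := @is_derive_solves_on _ _ `[a, b] _ _ dy.
  split=> // t; rewrite interior_itv_bnd => /subset_itv_oo_cc tab.
  by have := dy t; rewrite clamp_id.
- by rewrite /= /tau oriented_integral_refl g0.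
Qed.

(** * Conservation of H *)

(** On a segment the solution is bounded and the speeds can be extended, which
is all the argument needs; each time of an interval containing 0 lies together
with 0 in such a segment. *)
Lemma gda_H_const_segment (R : realType) (n m : nat)
    (f : 'rV[R]_n -> R) (g : 'rV[R]_m -> R) (v p q a b : R)
    (theta0 : 'rV[R]_n) (phi0 : 'rV[R]_m)
    (theta : R -> 'rV[R]_n) (phi : R -> 'rV[R]_m) :
  smooth f -> smooth g -> safe f g p q theta0 phi0 -> 0 \in `[a, b] ->
  theta 0 = theta0 -> phi 0 = phi0 ->
  hidden_gda f g v p q `[a, b] theta phi ->
  forall t, t \in `[a, b] ->
    gda_H f g p q theta0 phi0 (f (theta t)) (g (phi t)) =
    gda_H f g p q theta0 phi0 (f (theta 0)) (g (phi 0)).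
Proof.
move=> sf sg [nsf nsg [gamma [rp [ag pE]]] [delta [rq [ad qE]]]] ab0 th0 ph0.
move=> [sth sph].
have ab : a <= b by move: ab0; rewrite in_itv/= => /andP[]; exact: le_trans.
have comp_c k (h : 'rV[R]_k -> R) (x : R -> 'rV[R]_k) : smooth h ->
    {within `[a, b], continuous x} -> {within `[a, b], continuous (h \o x)}.
  move=> sh cx s; apply: (@continuous_comp (subspace `[a, b]) _ _ x h).
    exact: cx.
  exact/differentiable_continuous/smooth_differentiable.
pose cth t := - v * (g (phi t) - q); pose cph t := v * (f (theta t) - p).
have ccth : {within `[a, b], continuous cth}.
  move=> s; apply: cvgM; first exact: cvg_cst.
  by apply: cvgB; [exact: (comp_c _ _ _ sg sph.1)|exact: cvg_cst].
have ccph : {within `[a, b], continuous cph}.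
  move=> s; apply: cvgM; first exact: cvg_cst.
  by apply: cvgB; [exact: (comp_c _ _ _ sf sth.1)|exact: cvg_cst].
pose tau t := oriented_integral 0 t (cth \o clamp a b).
pose sigma t := oriented_integral 0 t (cph \o clamp a b).
have thE t : t \in `[a, b] -> theta t = gamma (tau t).
  exact: time_changed_ascent sf ag th0 ab0 ccth sth t.
have phE t : t \in `[a, b] -> phi t = delta (sigma t).
  exact: time_changed_ascent sg ad ph0 ab0 ccph sph t.
pose A s := oriented_integral rp s (fun u => f (gamma u) - p).
pose B s := oriented_integral rq s (fun u => g (delta u) - q).
have HE t : t \in `[a, b] ->
    gda_H f g p q theta0 phi0 (f (theta t)) (g (phi t)) =
    A (tau t) + B (sigma t).
  move=> tab; rewrite /gda_H thE// phE// pE qE.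
  by rewrite !oriented_integral_ascent// -pE -qE.
have dA (s : R) : is_derive s 1 A (f (gamma s) - p).
  apply: (@is_derive_oriented_integral _ (fun u => f (gamma u) - p)) => u.
  by apply: cvgB; [exact: (ascent_value_continuous sf ag)|exact: cvg_cst].
have dB (s : R) : is_derive s 1 B (g (delta s) - q).
  apply: (@is_derive_oriented_integral _ (fun u => g (delta u) - q)) => u.
  by apply: cvgB; [exact: (ascent_value_continuous sg ad)|exact: cvg_cst].
have dtau t :=
  is_derive_oriented_integral 0 t (continuous_comp_clamp ab ccth).
have dsigma t :=
  is_derive_oriented_integral 0 t (continuous_comp_clamp ab ccph).
have dD t := is_deriveD (is_derive1_comp (dA (tau t)) (dtau t))
                        (is_derive1_comp (dB (sigma t)) (dsigma t)).
(* The contributions - v (f - p) (g - q) and v (f - p) (g - q) cancel; inside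
   the segment the clamped speeds are the true ones. *)
have dD0 t : t \in `[a, b] ->
    (f (gamma (tau t)) - p) * (cth \o clamp a b) t
    + (g (delta (sigma t)) - q) * (cph \o clamp a b) t = 0.
  move=> tab; rewrite /= clamp_id// -thE// -phE// /cth /cph; ring.
suff D_const s t : a <= s -> s <= t -> t <= b ->
    A (tau s) + B (sigma s) = A (tau t) + B (sigma t).
  move=> t tab; rewrite (HE t tab) (HE 0 ab0).
  move: tab ab0; rewrite !in_itv/=.
  move=> /andP[a_t tb] /andP[a0 b0].
  by case: (leP t 0) => [t0|/ltW t0]; [|symmetry]; exact: D_const.
move=> a_s st tb.
have [c /andP[]] := MVT_segment st (fun x _ => dD x)
  (derivable_within_continuous (fun x _ => @ex_derive _ _ _ _ _ _ _ (dD x))).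
rewrite !bnd_simp => sc ct /=; rewrite dD0 ?mul0r; last first.
  by rewrite in_itv/= (le_trans a_s sc) (le_trans ct tb).
by move=> /subr0_eq/esym; rewrite !fctE; exact.
Qed.

Theorem theorem2 (R : realType) (n m : nat)
    (f : 'rV[R]_n -> R) (g : 'rV[R]_m -> R)
    (f01 : forall x, 0 <= f x <= 1) (g01 : forall y, 0 <= g y <= 1)
    (f_smooth : smooth f) (g_smooth : smooth g)
    (U : 'M[R]_2)
    (v_neq0 : game_v U <> 0)
    (q01 : 0 < game_q U < 1) (p01 : 0 < game_p U < 1)
    (theta0 : 'rV[R]_n) (phi0 : 'rV[R]_m)
    (init_safe : safe f g (game_p U) (game_q U) theta0 phi0)
    (I : interval R) (I0 : 0 \in I)
    (theta : R -> 'rV[R]_n) (phi : R -> 'rV[R]_m)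
    (theta_init : theta 0 = theta0) (phi_init : phi 0 = phi0)
    (sol : hidden_gda f g (game_v U) (game_p U) (game_q U) I theta phi) :
  forall s t : R, s \in I -> t \in I ->
    gda_H f g (game_p U) (game_q U) theta0 phi0 (f (theta s)) (g (phi s)) =
    gda_H f g (game_p U) (game_q U) theta0 phi0 (f (theta t)) (g (phi t)).
Proof.
suff H0 t : t \in I ->
    gda_H f g (game_p U) (game_q U) theta0 phi0 (f (theta t)) (g (phi t)) =
    gda_H f g (game_p U) (game_q U) theta0 phi0 (f (theta 0)) (g (phi 0)).
  by move=> s t sI tI; rewrite (H0 s sI) (H0 t tI).
move=> tI; pose a := Num.min 0 t; pose b := Num.max 0 t.
have abI : [set` `[a, b]] `<=` [set` I].
  move=> x; rewrite /= in_itv/= /a /b => xab.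
  have [t0|/ltW t0] := leP 0 t; move: xab.
    by rewrite min_l// max_r//; exact: (@interval_is_interval _ I 0 t).
  by rewrite min_r// max_l//; exact: (@interval_is_interval _ I t 0).
have [sth sph] := sol.
apply: (@gda_H_const_segment _ _ _ f g (game_v U) _ _ a b _ _ theta phi) => //.
- by rewrite in_itv/= /a /b ge_min le_max lexx.
- by split; [exact: solves_on_sub abI sth|exact: solves_on_sub abI sph].
- by rewrite in_itv/= /a /b ge_min le_max lexx !orbT.
Qed.
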